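(* Let $A_{-1},A_0,A_1,G,V$ be $n\times n$ matrices such that $A_0$ is invertible and $$A_1G^2+A_0G+A_{-1}=0,\qquad A_{-1}V^2+A_0V+A_1=0,$$ with $\rho(G)\le1$, $\rho(V)\le1$, $\rho(G)\rho(V)<1$. Let $\widetilde G$ be an $n\times n$ matrix such that $A_0+A_1\widetilde G$ and $I-\widetilde GV$ are invertible, and set $H=G-\widetilde G$, $Y=V(I-\widetilde GV)^{-1}$, $Z=(I-\widetilde GV)V(I-\widetilde GV)^{-1}$. Let $$P_0=-(A_0+A_1\widetilde G)^{-1}(A_1\widetilde G^2+A_0\widetilde G+A_{-1}),\quad E_0=\widetilde G+P_0,\quad F_0=Q_0=-(A_0+A_1\widetilde G)^{-1}A_1,$$ and assume that the SDA iteration with these initial values can be carried out with no breakdown, generating $E_k,F_k,P_k,Q_k$, $k\ge0$. Then $\lim_k P_k=H$ (so that $G_k=\widetilde G+P_k$ converges to $G$), and for all $k\ge0$ $$E_k=(I-Q_kH)G^{2^k},\quad H-P_k=F_kHG^{2^k},\quad F_k=(I-P_kY)Z^{2^k},\quad Y-Q_k=E_kYZ^{2^k}.$$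
   Context: $n$ is a positive integer and $\rho(\cdot)$ is the spectral radius. The SDA (Structure-preserving Doubling Algorithm) iteration with initial $n\times n$ matrices $E_0,F_0,P_0,Q_0$ is, for $k=0,1,\ldots$, $$E_{k+1}=E_k(I-Q_kP_k)^{-1}E_k,\qquad P_{k+1}=P_k+F_k(I-P_kQ_k)^{-1}P_kE_k,$$ $$F_{k+1}=F_k(I-P_kQ_k)^{-1}F_k,\qquad Q_{k+1}=Q_k+E_k(I-Q_kP_k)^{-1}Q_kF_k.$$ It can be carried out with no breakdown if $I-P_kQ_k$ and $I-Q_kP_k$ are invertible for all $k\ge0$. *)

(* Defs.v *)
From HB Require Import structures.
From mathcomp Require Import all_boot all_order all_algebra.
From mathcomp Require Import all_classical all_reals all_analysis.
From mathcomp Require Import complex.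

Set Implicit Arguments.
Unset Strict Implicit.
Unset Printing Implicit Defensive.

Import Order.TTheory GRing.Theory Num.Theory.
Import numFieldNormedType.Exports.

Local Open Scope classical_set_scope.
Local Open Scope ring_scope.

(* R[i] carries the topology of its modulus, which every numFieldType K has on
   K^o; 'M[R[i]]_n then gets the entrywise topology. *)
HB.instance Definition _ (R : realType) :=
  PseudoPointedMetric.copy R[i] (R[i])^o.
HB.instance Definition _ (R : realType) :=
  NormedModule.copy R[i] (R[i])^o.

(* For 0 < n the set of eigenvalues is finite and nonempty, so the supremum is
   the maximum of their moduli. *)
Definition spectral_radius (R : realType) (n : nat) (A : 'M[R[i]]_n) : R :=
  sup [set ComplexField.Normc.normc z | z in [set z : R[i] | eigenvalue A z]].

(* invmx M is M itself when M is singular: the recurrences have their intended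
   meaning only together with [sda_no_breakdown]. *)
Definition sda_iteration (K : fieldType) (n : nat)
    (E F P Q : nat -> 'M[K]_n) : Prop :=
  forall k : nat,
    [/\ E k.+1 = E k *m invmx (1%:M - Q k *m P k) *m E k,
        P k.+1 = P k + F k *m invmx (1%:M - P k *m Q k) *m P k *m E k,
        F k.+1 = F k *m invmx (1%:M - P k *m Q k) *m F k
      & Q k.+1 = Q k + E k *m invmx (1%:M - Q k *m P k) *m Q k *m F k].

Definition sda_no_breakdown (K : fieldType) (n : nat)
    (P Q : nat -> 'M[K]_n) : Prop :=
  forall k : nat,
    1%:M - P k *m Q k \in unitmx /\ 1%:M - Q k *m P k \in unitmx.

(* Main.v *)
Require Import Defs.
From HB Require Import structures.
From mathcomp Require Import all_boot all_order all_algebra.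
From mathcomp Require Import all_classical all_reals all_analysis.
From mathcomp Require Import complex.
From mathcomp Require Import ring lra.

Import Order.TTheory GRing.Theory Num.Theory.
Import numFieldNormedType.Exports.

Local Open Scope classical_set_scope.
Local Open Scope ring_scope.

(** The doubling iteration squares a pair of intertwining relations.  Put
    g = G^(2^k) and z = Z^(2^k).  If E = (I - QH) g and H - P = F H g, then one
    doubling step yields the same two relations with g^2 in place of g
    ([doubling_half]); exchanging (E, P, H, g) with (F, Q, Y, z) leaves the
    iteration unchanged, so the same computation serves F and Y - Q.  At k = 0
    the four relations restate the two matrix equations, after multiplication
    by the invertible matrices A0 + A1 Gt on the left and, for the last two,
    I - Gt V on the right ([sda_initial]).  Induction on k gives the four
    closed formulas ([sda_doubling]).

    For the convergence, let X = H - P_k and W = I - Gt V, so that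
    Z = W V W^-1 and Y W = V.  The formulas for H - P_k and F_k combine to
    X = ((I - H Y) W + X V) T  with  T = V^(2^k) W^-1 H G^(2^k)
    ([error_recurrence]).  Although P_k occurs on both sides, T -> 0 already
    forces X -> 0: once |V| |T| <= 1/2, the term X V T is absorbed in the left
    side ([cvg0_feedback]).

    That T -> 0 follows from rho(G) rho(V) < 1 once every r > rho(A) satisfies
    |A^m| <= C r^m ([norm1mx_pow_le]).  This growth bound comes from
    the Cayley-Hamilton theorem: removing the linear factors of the
    characteristic polynomial one at a time reduces it to the scalar
    recurrence a_{m+1} = z a_m + O(r^m) with |z| < r
    ([pow_bounded_by_factors]). *)

(** * The doubling algebra *)

(** Decides identities that hold in every noncommutative ring: after full
    expansion the monomials are abstracted, and what remains is linear, hence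
    can be checked entry by entry in the commutative ground ring. *)
Ltac mx_abel :=
  rewrite ?(mulmxBl, mulmxBr, mulmxDl, mulmxDr, mulmxN, mulNmx, mulmxA,
            mul1mx, mulmx1);
  repeat (let X := fresh "X" in set X := (_ *m _); clearbody X);
  apply/matrixP => ? ?; rewrite ?mxE; ring.

(** The first relation rests on
    I - Q'H = I - QH - E J Q F H with J = (I - QP)^-1; multiplied by g, the
    right side becomes E - E J Q (H - P) = E J (I - QH), and a second factor g
    turns this into E J E.  The second relation is obtained in the same way. *)
Lemma doubling_half {K : fieldType} {n : nat} {E F P Q H g : 'M[K]_n} :
  1%:M - P *m Q \in unitmx -> 1%:M - Q *m P \in unitmx ->
  E = (1%:M - Q *m H) *m g -> H - P = F *m H *m g ->
  E *m invmx (1%:M - Q *m P) *m E =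
    (1%:M - (Q + E *m invmx (1%:M - Q *m P) *m Q *m F) *m H) *m (g *m g) /\
  H - (P + F *m invmx (1%:M - P *m Q) *m P *m E) =
    F *m invmx (1%:M - P *m Q) *m F *m H *m (g *m g).
Proof.
move=> uPQ uQP hE hP.
have := mulVmx uQP; have := mulVmx uPQ.
move: (invmx (1%:M - Q *m P)) (invmx (1%:M - P *m Q)) => /= J L hL hJ; split.
  transitivity (E *m J *m ((1%:M - Q *m H) *m g)); first by rewrite -hE.
  transitivity (((1%:M - Q *m H) *m g - E *m J *m Q *m (F *m H *m g)) *m g);
    last by mx_abel.
  rewrite -[in RHS]hE -hP.
  transitivity ((E *m (J *m (1%:M - Q *m P)) - E *m J *m Q *m (H - P)) *m g).
    by mx_abel.
  by rewrite hJ mulmx1.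
transitivity (F *m L *m (F *m H *m g) *m g); last by mx_abel.
rewrite -hP.
transitivity (H - P - F *m L *m P *m E); first by mx_abel.
rewrite [in LHS]hP {1}hE.
transitivity (F *m (L *m (1%:M - P *m Q)) *m H *m g
              - F *m L *m P *m ((1%:M - Q *m H) *m g)).
  by rewrite hL mulmx1.
by mx_abel.
Qed.

(** The relations between the SDA matrices and the two invariant pairs (H, G)
    and (Y, Z): they say that the columns of [I; H] and of [Y; I] span deflating
    subspaces of the pencil [E, 0; -P, I] - t [I, -Q; 0, F]. *)
Definition sda_invariant {K : fieldType} {n : nat}
    (E F P Q H G Y Z : 'M[K]_n) : Prop :=
  [/\ E = (1%:M - Q *m H) *m G, H - P = F *m H *m G,
      F = (1%:M - P *m Y) *m Z & Y - Q = E *m Y *m Z].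

Lemma sda_doubling {K : fieldType} {n : nat}
    {E F P Q : nat -> 'M[K]_n} {H G Y Z : 'M[K]_n} :
  sda_iteration E F P Q -> sda_no_breakdown P Q ->
  sda_invariant (E 0%N) (F 0%N) (P 0%N) (Q 0%N) H G Y Z ->
  forall k, sda_invariant (E k) (F k) (P k) (Q k)
              H (G ^+ (2 ^ k)) Y (Z ^+ (2 ^ k)).
Proof.
move=> itS okS inv0; elim=> [|k [hE hP hF hQ]]; first by rewrite !expr1.
have [uPQ uQP] := okS k; have [-> -> -> ->] := itS k.
rewrite expnS mul2n -addnn !exprD -!mulmxE.
have [? ?] := doubling_half uPQ uQP hE hP.
by have [? ?] := doubling_half uQP uPQ hF hQ.
Qed.

(** Each relation is checked after cancelling M = A0 + A1 Gt on the left, which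
    turns P0, Q0 and Gt + P0 into polynomial expressions in the coefficients;
    the relations on Y and Z also need W = I - Gt V cancelled on the right, since
    Y W = V and Z W = W V. *)
Lemma sda_initial {K : fieldType} {n : nat}
    {Am1 A0 A1 G V Gt : 'M[K]_n} {P0 Q0 : 'M[K]_n} :
  A1 *m G ^+ 2 + A0 *m G + Am1 = 0 ->
  Am1 *m V ^+ 2 + A0 *m V + A1 = 0 ->
  A0 + A1 *m Gt \in unitmx ->
  1%:M - Gt *m V \in unitmx ->
  P0 = - (invmx (A0 + A1 *m Gt) *m (A1 *m Gt ^+ 2 + A0 *m Gt + Am1)) ->
  Q0 = - (invmx (A0 + A1 *m Gt) *m A1) ->
  sda_invariant (Gt + P0) Q0 P0 Q0 (G - Gt) G
    (V *m invmx (1%:M - Gt *m V))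
    ((1%:M - Gt *m V) *m V *m invmx (1%:M - Gt *m V)).
Proof.
rewrite !expr2 -!mulmxE => solG solV uM uW defP defQ.
set M := A0 + A1 *m Gt in uM defP defQ *; set W := 1%:M - Gt *m V in uW *.
have MP : M *m P0 = - (A1 *m (Gt *m Gt) + A0 *m Gt + Am1).
  by rewrite defP mulmxN mulKVmx.
have MQ : M *m Q0 = - A1 by rewrite defQ mulmxN mulKVmx.
have lcanM (B C : 'M[K]_n) : M *m B = M *m C -> B = C.
  by move/(congr1 (mulmx (invmx M))); rewrite !mulKmx.
have rcanW (B C : 'M[K]_n) : B *m W = C *m W -> B = C.
  by move/(congr1 (mulmx^~ (invmx W))); rewrite !mulmxK.
have YW : V *m invmx W *m W = V by rewrite mulmxKV.
have ZW : W *m V *m invmx W *m W = W *m V by rewrite mulmxKV.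
have defAm1 : Am1 = - (A1 *m (G *m G) + A0 *m G).
  by apply/eqP; rewrite -addr_eq0 addrC solG.
have defA1 : A1 = - (Am1 *m (V *m V) + A0 *m V).
  by apply/eqP; rewrite -addr_eq0 addrC solV.
have ME : M *m (Gt + P0) = - Am1 by rewrite mulmxDr MP /M; mx_abel.
split.
- apply: lcanM; rewrite ME !mulmxA mulmxBr mulmx1 mulmxA MQ defAm1 /M.
  by mx_abel.
- apply: lcanM; rewrite mulmxBr !mulmxA MP MQ defAm1 /M; mx_abel.
- apply: rcanW.
  transitivity ((W - P0 *m (V *m invmx W *m W)) *m V); last first.
    rewrite -[RHS]mulmxA ZW [RHS]mulmxA; congr (_ *m V).
    by rewrite mulmxBl mul1mx -(mulmxA P0).
  rewrite YW; apply: lcanM.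
  transitivity (M *m V - M *m (Gt + P0) *m V *m V); last by rewrite /W; mx_abel.
  rewrite mulmxA MQ ME {1}/W /M.
  transitivity (A1 *m Gt *m V - A1); first by mx_abel.
  by rewrite [X in _ - X = _]defA1; mx_abel.
- apply: rcanW.
  transitivity (V - Q0 *m W); first by rewrite mulmxBl YW.
  transitivity ((Gt + P0) *m (V *m invmx W *m W) *m V); last first.
    rewrite -[RHS]mulmxA ZW [RHS]mulmxA; congr (_ *m V).
    by rewrite -[RHS]mulmxA.
  rewrite YW; apply: lcanM.
  transitivity (M *m V - M *m Q0 *m W); first by mx_abel.
  rewrite mulmxA MQ mulmxA ME [in - A1 *m W]/W /M.
  transitivity (A0 *m V + A1); first by mx_abel.
  by rewrite [X in _ + X = _]defA1; mx_abel.
Qed.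

(** The substitution P = H - (H - P) in the formula for F makes the error
    H - P appear on the right side too, multiplied by a factor that tends
    to 0; the left factor W is kept outside so that only powers of V and G are
    ever estimated. *)
Lemma error_recurrence {K : fieldType} {n : nat}
    {F P H Y V W Vm W' Gm : 'M[K]_n} :
  Y *m W = V -> F = (1%:M - P *m Y) *m (W *m Vm *m W') ->
  H - P = F *m H *m Gm ->
  H - P = ((1%:M - H *m Y) *m W + (H - P) *m V) *m (Vm *m (W' *m H) *m Gm).
Proof.
move=> <- defF defP; rewrite [LHS]defP defF.
by mx_abel.
Qed.

Lemma conj_expmx {K : fieldType} {n : nat} {W : 'M[K]_n} (V : 'M[K]_n) m :
  W \in unitmx -> (W *m V *m invmx W) ^+ m = W *m V ^+ m *m invmx W.
Proof.
move=> uW; elim: m => [|m IHm]; first by rewrite !expr0 mulmx1 mulmxV.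
by rewrite !exprS -!mulmxE IHm !mulmxA mulmxKV.
Qed.

(** * A submultiplicative norm *)

Local Notation normc := ComplexField.Normc.normc.

Lemma normc_ge0 {R : realType} (z : R[i]) : 0 <= normc z.
Proof. by case: z => a b; exact: sqrtr_ge0. Qed.

Lemma normc_sum {R : realType} {I : Type} (s : seq I) (f : I -> R[i]) :
  normc (\sum_(i <- s) f i) <= \sum_(i <- s) normc (f i).
Proof.
elim/big_rec2: _ => [|i x y _ le_yx]; first by rewrite ComplexField.Normc.normc0.
by apply: (le_trans (le_normcD _ _)); rewrite lerD2l.
Qed.

(** The sum of the moduli is real-valued, submultiplicative and defined for
    all sizes, including empty matrices. *)
Definition norm1mx {R : realType} {m n : nat} (A : 'M[R[i]]_(m, n)) : R :=
  \sum_i \sum_j normc (A i j).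

Lemma norm1mx_ge0 {R : realType} {m n} (A : 'M[R[i]]_(m, n)) : 0 <= norm1mx A.
Proof. by apply: sumr_ge0 => i _; apply: sumr_ge0 => j _; exact: normc_ge0. Qed.

Lemma norm1mx0 {R : realType} {m n} : norm1mx (0 : 'M[R[i]]_(m, n)) = 0.
Proof.
by apply: big1 => i _; apply: big1 => j _; rewrite mxE ComplexField.Normc.normc0.
Qed.

Lemma norm1mxD {R : realType} {m n} (A B : 'M[R[i]]_(m, n)) :
  norm1mx (A + B) <= norm1mx A + norm1mx B.
Proof.
rewrite -big_split; apply: ler_sum => i _; rewrite -big_split.
by apply: ler_sum => j _; rewrite mxE; exact: le_normcD.
Qed.

Lemma norm1mxZ {R : realType} {m n} (a : R[i]) (A : 'M[R[i]]_(m, n)) :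
  norm1mx (a *: A) = normc a * norm1mx A.
Proof.
rewrite mulr_sumr; apply: eq_bigr => i _; rewrite mulr_sumr.
by apply: eq_bigr => j _; rewrite mxE ComplexField.Normc.normcM.
Qed.

Lemma norm1mx_row {R : realType} {m n} (A : 'M[R[i]]_(m, n)) i :
  \sum_j normc (A i j) <= norm1mx A.
Proof.
rewrite /norm1mx (bigD1 i) //= lerDl; apply: sumr_ge0 => k _.
by apply: sumr_ge0 => j _; exact: normc_ge0.
Qed.

Lemma norm1mx_entry {R : realType} {m n} (A : 'M[R[i]]_(m, n)) i j :
  normc (A i j) <= norm1mx A.
Proof.
apply: le_trans (norm1mx_row A i).
by rewrite (bigD1 j) //= lerDl; apply: sumr_ge0 => k _; exact: normc_ge0.
Qed.

Lemma norm1mxM {R : realType} {m n p} (A : 'M[R[i]]_(m, n)) (B : 'M[R[i]]_(n, p)) :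
  norm1mx (A *m B) <= norm1mx A * norm1mx B.
Proof.
rewrite /norm1mx mulr_suml; apply: ler_sum => i _; rewrite mulr_suml.
have le1 (j : 'I_p) : true ->
    normc ((A *m B) i j) <= \sum_k normc (A i k) * normc (B k j).
  move=> _; rewrite mxE.
  have := normc_sum (index_enum _) (fun k => A i k * B k j).
  move=> h; apply: (le_trans h).
  by apply: ler_sum => k _; rewrite ComplexField.Normc.normcM.
apply: (le_trans (ler_sum _ le1)); rewrite exchange_big /=.
apply: ler_sum => k _; rewrite -mulr_sumr.
by apply: ler_wpM2l; [exact: normc_ge0 | exact: norm1mx_row].
Qed.

(** Induction on the factors, with B generalised: for the first root z the
    matrix B (A - z) is annihilated by the remaining factors, so that
    B A^(m+1) = z B A^m + O(r^m), and |z| < r keeps the geometric rate r. *)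
Lemma pow_bounded_by_factors {R : realType} {n} (A : 'M[R[i]]_n.+1) (r : R)
    (s : seq R[i]) :
  (forall z, z \in s -> normc z < r) ->
  forall B : 'M[R[i]]_n.+1, B * \prod_(z <- s) (A - z%:M) = 0 ->
  exists C, forall m, norm1mx (B * A ^+ m) <= C * r ^+ m.
Proof.
elim: s => [_ B|z s IHs ltr B].
  rewrite big_nil mulr1 => ->; exists 0 => m.
  by rewrite mul0r [norm1mx _]norm1mx0 mul0r.
rewrite big_cons mulrA => hB.
have ltzr : normc z < r by apply: ltr; rewrite mem_head.
have r_ge0 : 0 <= r by apply: le_trans (normc_ge0 z) (ltW ltzr).
have [|C hC] := IHs _ _ hB.
  by move=> x xs; apply: ltr; rewrite inE xs orbT.
(* The bound D propagates from m to m + 1 when C + |z| D <= r D. *)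
exists (Num.max (norm1mx B) (C / (r - normc z))); set D := Num.max _ _.
have leCD : C <= (r - normc z) * D.
  by rewrite mulrC -ler_pdivrMr ?subr_gt0// le_max lexx orbT.
elim=> [|m IHm]; first by rewrite !expr0 !mulr1 le_max lexx.
have -> : B * A ^+ m.+1 = B * (A - z%:M) * A ^+ m + z *: (B * A ^+ m).
  rewrite mulrBr mulrBl exprS mulrA -[z%:M]mulr1.
  by rewrite [z%:M * 1]mul_scalar_mx -scalerAr mulr1 -scalerAl subrK.
apply: (le_trans (norm1mxD _ _)); rewrite norm1mxZ.
apply: (@le_trans _ _ ((r - normc z) * D * r ^+ m + normc z * (D * r ^+ m))).
  apply: lerD; last by apply: ler_wpM2l; [exact: normc_ge0|].
  by apply: le_trans (hC m) _; apply: ler_wpM2r => //; exact: exprn_ge0.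
by rewrite le_eqVlt; apply/orP; left; apply/eqP; rewrite exprS; ring.
Qed.

(** * Spectral radius *)

Lemma char_poly_roots {R : realType} {n} (A : 'M[R[i]]_n) :
  {s : seq R[i] | char_poly A = \prod_(z <- s) ('X - z%:P) &
                  forall z, eigenvalue A z = (z \in s)}.
Proof.
have [s hs] := closed_field_poly_normal (char_poly A).
rewrite (monicP (char_poly_monic A)) scale1r in hs.
by exists s => // z; rewrite eigenvalue_root_char hs root_prod_XsubC.
Qed.

Lemma eigenvalue_le_spectral_radius {R : realType} {n} {A : 'M[R[i]]_n} {z} :
  eigenvalue A z -> normc z <= spectral_radius A.
Proof.
move=> Az; apply: ub_le_sup; last by exists z.
have [s _ hs] := char_poly_roots A.
exists (\sum_(x <- s) normc x) => _ [x /= Ax <-].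
rewrite hs in Ax; rewrite (big_rem x Ax) /= lerDl.
by apply: sumr_ge0 => y _; exact: normc_ge0.
Qed.

Lemma spectral_radius_ge0 {R : realType} {n} (A : 'M[R[i]]_n) :
  0 <= spectral_radius A.
Proof.
have [[z Az]|noev] := pselect (exists z, eigenvalue A z).
 exact: le_trans (normc_ge0 z) (eigenvalue_le_spectral_radius Az).
rewrite /spectral_radius [X in image X _](_ : _ = set0) ?image_set0 ?sup0//.
by rewrite -subset0 => z Az; apply: noev; exists z.
Qed.

Lemma norm1mx_pow_le {R : realType} {n} (A : 'M[R[i]]_n) (r : R) :
  spectral_radius A < r -> exists C, forall m, norm1mx (A ^+ m) <= C * r ^+ m.
Proof.
case: n A => [|n] A ltr.
  by exists 0 => m; rewrite mul0r /norm1mx big_ord0.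
have [s chiA hs] := char_poly_roots A.
have [||C hC] := pow_bounded_by_factors A r s _ 1.
- by move=> z; rewrite -hs => Az; apply: le_lt_trans ltr;
  exact: eigenvalue_le_spectral_radius.
- rewrite mul1r -[RHS](Cayley_Hamilton A) chiA rmorph_prod.
  by apply: eq_bigr => z _; rewrite rmorphB /= horner_mx_X horner_mx_C.
by exists C => m; rewrite -[A ^+ m]mul1r.
Qed.

(** * Convergence *)

Lemma cvg_norm1mx {R : realType} {n} (X : nat -> 'M[R[i]]_n) (L : 'M[R[i]]_n) :
  norm1mx (L - X k) @[k --> \oo] --> 0 -> X k @[k --> \oo] --> L.
Proof.
move=> /cvgrPdist_lt cvX; apply/cvg_ballP => e e0.
have [e_re e_gt0] : e = (complex.Re e)%:C%C /\ 0 < complex.Re e.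
  by move: e0; case: e => a b; rewrite ltcE /= => /andP[/eqP -> a0]; split.
apply: filterS (cvX _ e_gt0) => k; rewrite sub0r normrN => ltk.
split=> // i j; rewrite /ball /= e_re.
suff : normc ((L - X k) i j) < complex.Re e by rewrite -ltcR !mxE.
exact: le_lt_trans (norm1mx_entry _ _ _) (le_lt_trans (ler_norm _) ltk).
Qed.

(** As soon as |Y| |T| <= 1/2, the triangle inequality gives
    |X| <= |U| |T| + |X| / 2, that is, |X| <= 2 |U| |T|. *)
Lemma cvg0_feedback {R : realType} {n} {X T : nat -> 'M[R[i]]_n}
    {U Y : 'M[R[i]]_n} :
  (forall k, X k = (U + X k *m Y) *m T k) ->
  norm1mx (T k) @[k --> \oo] --> 0 -> norm1mx (X k) @[k --> \oo] --> 0.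
Proof.
move=> hX cvT.
have cvUT : 2 * norm1mx U * norm1mx (T k) @[k --> \oo] --> 0.
  by rewrite -[X in _ --> X](mulr0 (2 * norm1mx U)); apply: cvgMr.
have cvYT : norm1mx Y * norm1mx (T k) @[k --> \oo] --> 0.
  by rewrite -[X in _ --> X](mulr0 (norm1mx Y)); apply: cvgMr.
apply: squeeze_cvgr (cvg_cst 0) cvUT.
have half_gt0 : 0 < 2^-1 :> R by rewrite invr_gt0.
move/cvgrPdist_lt : cvYT => /(_ _ half_gt0); apply: filterS => k.
rewrite sub0r normrN => /(le_lt_trans (ler_norm _)) small.
rewrite norm1mx_ge0 /=.
have le1 : norm1mx (X k) <=
    norm1mx U * norm1mx (T k) + norm1mx (X k) * (norm1mx Y * norm1mx (T k)).
  rewrite {1}hX mulmxDl -mulmxA; apply: le_trans (norm1mxD _ _) _.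
  by apply: lerD; first exact: norm1mxM; apply: le_trans (norm1mxM _ _) _;
     apply: ler_wpM2l; [exact: norm1mx_ge0 | exact: norm1mxM].
have := ler_wpM2l (norm1mx_ge0 (X k)) (ltW small).
lra.
Qed.

Lemma product_margin {R : realType} (g v : R) :
  0 <= g <= 1 -> 0 <= v <= 1 -> g * v < 1 ->
  exists2 e, 0 < e & (v + e) * (g + e) < 1.
Proof.
move=> /andP[g0 g1] /andP[v0 v1] gv1; pose e := (1 - g * v) / 4.
have gv0 : 0 <= g * v by exact: mulr_ge0.
have e0 : 0 < e by rewrite /e; lra.
exists e => //.
have eg : e * g <= e by rewrite ler_piMr // ltW.
have ev : e * v <= e by rewrite ler_piMr // ltW.
have ee : e * e <= e / 4 by rewrite ler_wpM2l ?(ltW e0)// /e; lra.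
have eE : 4 * e = 1 - g * v by rewrite /e; lra.
rewrite mulrDl !mulrDr (mulrC v e) (mulrC v g).
by clearbody e; lra.
Qed.

Lemma geometric_two_sided_cvg0 {R : realType} {n} {G V : 'M[R[i]]_n}
    (B : 'M[R[i]]_n)
    {g v D D' : R} :
  0 <= g -> 0 <= v -> v * g < 1 ->
  (forall m, norm1mx (G ^+ m) <= D * g ^+ m) ->
  (forall m, norm1mx (V ^+ m) <= D' * v ^+ m) ->
  norm1mx (V ^+ (2 ^ k) *m B *m G ^+ (2 ^ k)) @[k --> \oo] --> 0.
Proof.
move=> g0 v0 lt_q1 hD hD'; set q := v * g in lt_q1.
have q0 : 0 <= q by exact: mulr_ge0.
have D0 : 0 <= D.
  by have := hD 0%N; rewrite expr0 mulr1; apply: le_trans (norm1mx_ge0 _).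
have D'0 : 0 <= D'.
  by have := hD' 0%N; rewrite expr0 mulr1; apply: le_trans (norm1mx_ge0 _).
apply: (squeeze_cvgr _ (cvg_cst 0)
          (@cvg_geometric _ (D' * norm1mx B * D) q _)); last first.
  by rewrite ger0_norm.
near=> k; rewrite norm1mx_ge0 /=.
apply: le_trans (norm1mxM _ _) _.
apply: (@le_trans _ _ ((D' * v ^+ (2 ^ k) * norm1mx B) * (D * g ^+ (2 ^ k)))).
  apply: ler_pM; rewrite ?norm1mx_ge0//.
  by apply: le_trans (norm1mxM _ _) _; apply: ler_wpM2r; rewrite ?norm1mx_ge0.
apply: (@le_trans _ _ (D' * norm1mx B * D * q ^+ (2 ^ k))).
  by rewrite le_eqVlt /q exprMn; apply/orP; left; apply/eqP; ring.
rewrite /geometric /=; apply: ler_wpM2l; first by rewrite !mulr_ge0 ?norm1mx_ge0.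
apply: ler_wiXn2l => //; first exact: ltW.
exact/ltnW/ltn_expl.
Unshelve. all: by end_near. Qed.

(** There is room for radii g > rho(G) and v > rho(V) with v g < 1, so the
    growth bounds on the powers of G and V combine into a geometric decay. *)
Lemma spectral_two_sided_cvg0 {R : realType} {n} {G V : 'M[R[i]]_n}
    (B : 'M[R[i]]_n) :
  spectral_radius G <= 1 -> spectral_radius V <= 1 ->
  spectral_radius G * spectral_radius V < 1 ->
  norm1mx (V ^+ (2 ^ k) *m B *m G ^+ (2 ^ k)) @[k --> \oo] --> 0.
Proof.
have := (spectral_radius_ge0 G, spectral_radius_ge0 V).
have := (@norm1mx_pow_le R n G, @norm1mx_pow_le R n V).
move: (spectral_radius G) (spectral_radius V) => g v.
move=> [powG powV] [g0 v0] g1 v1 gv1.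
have [||e e0 lt1] := product_margin g v _ _ gv1; rewrite ?g0 ?v0 //.
have [|D hD] := powG (g + e); first by rewrite ltrDl.
have [|D' hD'] := powV (v + e); first by rewrite ltrDl.
by apply: geometric_two_sided_cvg0 lt1 hD hD'; rewrite addr_ge0 // ltW.
Qed.


Theorem mainTheorem4 (R : realType) (n : nat) (n_gt0 : (0 < n)%N)
    (Am1 A0 A1 G V : 'M[R[i]]_n)
    (A0_unit : A0 \in unitmx)
    (G_sol : A1 *m G ^+ 2 + A0 *m G + Am1 = 0)
    (V_sol : Am1 *m V ^+ 2 + A0 *m V + A1 = 0)
    (rhoG : spectral_radius G <= 1)
    (rhoV : spectral_radius V <= 1)
    (rhoGV : spectral_radius G * spectral_radius V < 1)
    (Gt : 'M[R[i]]_n)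
    (AGt_unit : A0 + A1 *m Gt \in unitmx)
    (GtV_unit : 1%:M - Gt *m V \in unitmx)
    (H Y Z : 'M[R[i]]_n)
    (H_def : H = G - Gt)
    (Y_def : Y = V *m invmx (1%:M - Gt *m V))
    (Z_def : Z = (1%:M - Gt *m V) *m V *m invmx (1%:M - Gt *m V))
    (E F P Q : nat -> 'M[R[i]]_n)
    (P0_def : P 0%N =
       - (invmx (A0 + A1 *m Gt) *m (A1 *m Gt ^+ 2 + A0 *m Gt + Am1)))
    (E0_def : E 0%N = Gt + P 0%N)
    (F0_def : F 0%N = - (invmx (A0 + A1 *m Gt) *m A1))
    (Q0_def : Q 0%N = - (invmx (A0 + A1 *m Gt) *m A1))
    (EFPQ_sda : sda_iteration E F P Q)
    (EFPQ_ok : sda_no_breakdown P Q) :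
  [/\ P k @[k --> \oo] --> H,
      (Gt + P k) @[k --> \oo] --> G
    & forall k : nat,
        [/\ E k = (1%:M - Q k *m H) *m G ^+ (2 ^ k),
            H - P k = F k *m H *m G ^+ (2 ^ k),
            F k = (1%:M - P k *m Y) *m Z ^+ (2 ^ k)
          & Y - Q k = E k *m Y *m Z ^+ (2 ^ k)]].
Proof.
have YW : Y *m (1%:M - Gt *m V) = V by rewrite Y_def mulmxKV.
have init : sda_invariant (E 0%N) (F 0%N) (P 0%N) (Q 0%N) H G Y Z.
  rewrite E0_def F0_def -Q0_def H_def Y_def Z_def.
  exact: sda_initial G_sol V_sol AGt_unit GtV_unit P0_def Q0_def.
have inv := sda_doubling EFPQ_sda EFPQ_ok init.
set W := 1%:M - Gt *m V in GtV_unit YW Z_def.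
pose T k := V ^+ (2 ^ k) *m (invmx W *m H) *m G ^+ (2 ^ k).
have errE k : H - P k = ((1%:M - H *m Y) *m W + (H - P k) *m V) *m T k.
  have [_ hP hF _] := inv k.
  by apply: error_recurrence YW _ hP; rewrite hF Z_def conj_expmx.
have cvT : norm1mx (T k) @[k --> \oo] --> 0.
  exact: spectral_two_sided_cvg0.
have cvP : norm1mx (H - P k) @[k --> \oo] --> 0 := cvg0_feedback errE cvT.
split; [exact: cvg_norm1mx | | exact: inv].
apply: cvg_norm1mx; rewrite (_ : (fun k => _) = (fun k => norm1mx (H - P k))) //.
by apply/funext => k; rewrite H_def opprD addrA.
Qed.
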